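(* Let $f\in C^1(\mathbb{R})$ be a non-decreasing function. Let $\Phi:\mathbb{R}\to\mathbb{R}$ be a continuous, non-decreasing function satisfying $\Phi(z)\ge 0$ for $z\ge 0$ and $\Phi(-z)=-\Phi(z)$, such that $\Phi$ is locally Lipschitz-continuous and the limit $\lim_{z\to0}\frac{\Phi(z)}{z}$ exists and is finite. Let $$F(a,b)=\frac{\Phi\big(f(a)-f(b)\big)}{a-b}\ \text{ for } a\neq b,\qquad F(a,a)=f'(a)\lim_{z\to0}\frac{\Phi(z)}{z},$$ and let $\mu$ be the density of a Lévy measure with low singularity. Then $\rho(a,b;x,y)=F(a,b)\,\mu(|x-y|)$ is a homogeneous jump kernel.
   Context: Density of a Lévy measure with low singularity: a non-negative (Borel) function $\mu:[0,\infty)\to[0,\infty)$ with $\int_{\mathbb{R}^N}(1\wedge|y|)\,\mu(|y|)\,dy<\infty$. Homogeneous jump kernel: a function $\rho:(\mathbb{R}\times\mathbb{R})\times(\mathbb{R}^N\times\mathbb{R}^N)\to\mathbb{R}$, written $\rho(a,b;x,y)$, such that for all $a,b,c,d\in\mathbb{R}$ and almost every $(x,y)\in\mathbb{R}^N\times\mathbb{R}^N$: (A1) $\rho$ is a non-negative Borel function; (A2) $\rho(a,b;x,y)=\rho(b,a;y,x)$; (A3) $(a-b)\rho(a,b;x,y)\ge(c-d)\rho(c,d;x,y)$ whenever $a\ge c\ge d\ge b$; (A4) $\rho(a,b;x,y)=\rho(a,b;|x-y|)$, i.e. $\rho$ depends on $x,y$ only through $|x-y|$; (A5) for every $R>0$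 there is a function $m_R:[0,\infty)\to[0,\infty)$ such that $\sup_{-R\le a,b\le R}\rho(a,b;x,y)\le m_R(|x-y|)$ and $\int_{\mathbb{R}^N}(1\wedge|y|)\,m_R(|y|)\,dy=K_R<\infty$; (A6) $\rho$ is continuous with respect to the first two variables, and for every $\varepsilon>0$ and every $R>\varepsilon$ there is a constant $C_{R,\varepsilon}$ such that $|\rho(a,b;x,y)-\rho(c,d;x,y)|\le C_{R,\varepsilon}(|a-c|+|b-d|)\,m_R(|x-y|)$ for all $a,b,c,d\in[-R,R]$ with $|a-b|\ge\varepsilon$ and $|c-d|\ge\varepsilon$. *)

(* Defs.v *)
From HB Require Import structures.
From mathcomp Require Import all_boot all_order all_algebra.
From mathcomp Require Import all_classical all_reals all_analysis.

Set Implicit Arguments.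
Unset Strict Implicit.
Unset Printing Implicit Defensive.

Import Order.TTheory GRing.Theory Num.Theory.
Import numFieldNormedType.Exports.

Local Open Scope classical_set_scope.
Local Open Scope ring_scope.

(* R^N is [N.-tuple R]: it carries the product sigma-algebra, i.e. the Borel
   sets.  Its Lebesgue measure is built by induction on N, from the Dirac mass
   on the one-point space R^0 and R^(N+1) = R x R^N. *)
Section lebesgue_measure_tuple.
Context {R : realType}.

Definition tcons (n : nat) (z : R * n.-tuple R) : n.+1.-tuple R :=
  [the n.+1.-tuple R of z.1 :: z.2].

Lemma measurable_tcons (n : nat) : measurable_fun setT (@tcons n).
Proof. exact: measurable_cons. Qed.

Section step.
Context (n : nat) (m : {sigma_finite_measure set (n.-tuple R) -> \bar R}).

Definition lebesgue_step : set (n.+1.-tuple R) -> \bar R :=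
  pushforward (@lebesgue_measure R \x m)%E (@tcons n).

Let lebesgue_step0 : lebesgue_step set0 = 0%E.
Proof. by rewrite /lebesgue_step /pushforward preimage_set0 measure0. Qed.

Let lebesgue_step_ge0 A : (0 <= lebesgue_step A)%E.
Proof. by rewrite /lebesgue_step /pushforward; exact: measure_ge0. Qed.

Let lebesgue_step_sigma_additive : semi_sigma_additive lebesgue_step.
Proof.
move=> F mF tF mUF; rewrite /lebesgue_step /pushforward preimage_bigcup.
apply: measure_semi_sigma_additive.
- by move=> k; rewrite -[X in measurable X]setTI; exact: measurable_tcons.
- apply/trivIsetP => /= i j _ _ ij; rewrite -preimage_setI.
  by move/trivIsetP : tF => /(_ _ _ _ _ ij) ->//; rewrite preimage_set0.
- by rewrite -preimage_bigcup -[X in measurable X]setTI; exact: measurable_tcons.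
Qed.

HB.instance Definition _ := isMeasure.Build _ _ _ lebesgue_step
  lebesgue_step0 lebesgue_step_ge0 lebesgue_step_sigma_additive.

Let lebesgue_step_sigma_finite : sigma_finite setT lebesgue_step.
Proof.
have /sigma_finiteP[F [FT ndF Foo]] := sigma_finiteT (@lebesgue_measure R).
have /sigma_finiteP[G [GT ndG Goo]] := sigma_finiteT m.
pose g (t : n.+1.-tuple R) : R * n.-tuple R := (thead t, [tuple of behead t]).
have mg : measurable_fun setT g.
  apply/measurable_fun_pair => /=; last exact: measurable_behead.
  exact: measurable_tnth.
have gK : cancel (@tcons n) g.
  by move=> [x t]; rewrite /g theadE; congr pair; exact/val_inj.
exists (fun k => g @^-1` (F k `*` G k)).
  rewrite -preimage_bigcup (_ : \bigcup_k _ = setT) ?preimage_setT//.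
  rewrite -setXTT FT GT predeqE => -[x t]; split.
    by move=> [k _ []/= ? ?]; split; exists k.
  move=> [/= [i _ Fix] [j _ Gjt]]; exists (maxn i j) => //; split.
  - by move: x Fix; exact/subsetPset/ndF/leq_maxl.
  - by move: t Gjt; exact/subsetPset/ndG/leq_maxr.
move=> k; have [mF Fkoo] := Foo k; have [mG Gkoo] := Goo k; split.
  by rewrite -[X in measurable X]setTI; apply: mg => //; exact: measurableX.
rewrite /lebesgue_step /pushforward (_ : _ @^-1` _ = F k `*` G k).
  by rewrite product_measure1E// lte_mul_pinfty// ge0_fin_numE.
by apply/funext => z; exact: (congr1 (F k `*` G k) (gK z)).
Qed.

HB.instance Definition _ :=
  Measure_isSigmaFinite.Build _ _ _ lebesgue_step lebesgue_step_sigma_finite.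

End step.

Fixpoint lebesgue_tuple (n : nat) :
    {sigma_finite_measure set (n.-tuple R) -> \bar R} :=
  match n with
  | 0 => \d_([tuple] : 0.-tuple R)
  | n'.+1 => lebesgue_step (lebesgue_tuple n')
  end.

End lebesgue_measure_tuple.

Section box.
Context {R : realType}.

Lemma lebesgue_tuple_box (n : nat) (A : 'I_n -> set R) :
  (forall i, measurable (A i)) ->
  lebesgue_tuple n [set x | forall i, A i (tnth x i)] =
  (\prod_(i < n) @lebesgue_measure R (A i))%E.
Proof.
elim: n A => [|n IH] A mA.
  rewrite big_ord0 /= diracE mem_set// => -[]//.
rewrite big_ord_recl -IH//= /lebesgue_step /pushforward.
have -> : (@tcons R n) @^-1` [set x | forall i, A i (tnth x i)] =
    A ord0 `*` [set x | forall i, A (lift ord0 i) (tnth x i)].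
  apply/seteqP; split=> -[x t] /=.
    by move=> h; split=> [|i]; [exact: (h ord0)|have := h (lift ord0 i); rewrite tnthS].
  by move=> [h0 hS] i; case: (unliftP ord0 i) => [j ->|->//]; rewrite tnthS.
have mB : measurable [set x : n.-tuple R |
    forall i : 'I_n, A (lift ord0 i) (tnth x i)].
  have -> : [set x : n.-tuple R | forall i : 'I_n, A (lift ord0 i) (tnth x i)]
    = \bigcap_(i in setT) ((fun x => tnth x i) @^-1` A (lift ord0 i)).
    by apply/seteqP; split=> x /= h i; [move=> _|]; exact: h.
  apply: fin_bigcap_measurable => // i _; rewrite -[X in measurable X]setTI.
  exact: measurable_tnth.
by rewrite product_measure1E//; exact: (mA ord0).
Qed.

End box.

Section jump_kernel.
Context {R : realType}.

Definition eucl_norm (N : nat) (x : N.-tuple R) : R :=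
  Num.sqrt (\sum_(i < N) tnth x i ^+ 2).

Definition eucl_dist (N : nat) (x y : N.-tuple R) : R :=
  eucl_norm [tuple tnth x i - tnth y i | i < N].

(* A function [0, oo) -> [0, oo) is represented by a function on R of which
   only the restriction to [0, oo) is constrained. *)
Definition low_singularity_density (N : nat) (mu : R -> R) : Prop :=
  [/\ measurable_fun (`[0, +oo[ : set R) mu,
      forall r, 0 <= r -> 0 <= mu r &
      (\int[lebesgue_tuple N]_y (Num.min 1 (eucl_norm y) * mu (eucl_norm y))%:E
         < +oo)%E].

Definition ae_pair (N : nat) (P : N.-tuple R -> N.-tuple R -> Prop) : Prop :=
  {ae (lebesgue_tuple N \x lebesgue_tuple N)%E, forall z, P z.1 z.2}.

Section conditions.
Context (N : nat) (rho : R * R -> N.-tuple R * N.-tuple R -> R).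

Definition kernel_borel_ge0 : Prop :=
  measurable_fun setT
    (fun w : (R * R) * (N.-tuple R * N.-tuple R) => rho w.1 w.2) /\
  forall ab xy, 0 <= rho ab xy.

Definition kernel_symmetric : Prop :=
  ae_pair (fun x y => forall a b, rho (a, b) (x, y) = rho (b, a) (y, x)).

Definition kernel_monotone : Prop :=
  ae_pair (fun x y => forall a b c d, c <= a -> d <= c -> b <= d ->
    (c - d) * rho (c, d) (x, y) <= (a - b) * rho (a, b) (x, y)).

Definition kernel_homogeneous : Prop :=
  exists r : R * R -> R -> R,
    ae_pair (fun x y => forall ab, rho ab (x, y) = r ab (eucl_dist x y)).

Definition kernel_bound (K : R) (m : R -> R) : Prop :=
  ae_pair (fun x y =>
    (ereal_sup [set (rho ab (x, y))%:E | ab in (`[- K, K] `*` `[- K, K])%R]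
       <= (m (eucl_dist x y))%:E)%E).

Definition kernel_continuous : Prop :=
  ae_pair (fun x y => continuous (fun ab : R * R => rho ab (x, y))).

Definition kernel_lipschitz (K e C : R) (m : R -> R) : Prop :=
  ae_pair (fun x y => forall a b c d,
    a \in `[- K, K] -> b \in `[- K, K] -> c \in `[- K, K] -> d \in `[- K, K] ->
    e <= `|a - b| -> e <= `|c - d| ->
    `|rho (a, b) (x, y) - rho (c, d) (x, y)| <=
      C * (`|a - c| + `|b - d|) * m (eucl_dist x y)).

(* Each almost-everywhere condition has a single null set of pairs (x, y), valid
   for all values a, b, c, d.  The bounds [m K] of the sup condition are also
   those of the Lipschitz condition. *)
Definition homogeneous_jump_kernel : Prop :=
  [/\ kernel_borel_ge0, kernel_symmetric, kernel_monotone, kernel_homogeneous &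
      exists m : R -> R -> R,
      [/\ forall K, 0 < K ->
            kernel_bound K (m K) /\ low_singularity_density N (m K),
          kernel_continuous &
          forall e K, 0 < e -> e < K ->
            exists C, kernel_lipschitz K e C (m K)]].

End conditions.

Definition difference_quotient (f Phi : R -> R) (a b : R) : R :=
  if a == b then derive1 f a * lim (Phi z / z @[z --> (0 : R)^'])
  else Phi (f a - f b) / (a - b).

End jump_kernel.

(* Main.v *)
Require Import Defs.
From mathcomp Require Import all_boot all_order all_algebra.
From mathcomp Require Import all_classical all_reals all_analysis.
From mathcomp Require Import measurable_realfun.
From mathcomp Require Import ring lra.

Set Implicit Arguments.
Unset Strict Implicit.
Unset Printing Implicit Defensive.

Import Order.TTheory GRing.Theory Num.Theory.
Import numFieldNormedType.Exports.
Local Open Scope classical_set_scope.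
Local Open Scope ring_scope.

(** Write F for [difference_quotient f Phi] and rho = F(a,b) mu(|x - y|).

Everything rests on two identities for F.  The first, which holds also for
a = b, is (a - b) F(a,b) = Phi (f a - f b) ([difference_quotientK]).  Since Phi
is odd and Phi and f are non-decreasing, it gives the symmetry of F, the sign
of F off the diagonal, and the monotonicity condition
(c - d) F(c,d) <= (a - b) F(a,b) for b <= d <= c <= a.

The second is the factorization F(a,b) = G (f a - f b) H(a,b)
([difference_quotient_factor]), where G z = Phi z / z is extended at 0 by its
limit and H is the divided difference of f, extended to the diagonal by f'.
The function G is continuous because the limit exists; H is continuous because
by the mean value theorem it takes, near (a,a), only values of f' near a.
Hence F is continuous on the plane ([continuous_difference_quotient]); in
particular F is non-negative on the diagonal too, and bounded on each square
[-K,K]^2 by some M_K, which can be taken >= 1.  The bounding densities of the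
kernel are m_K = M_K mu.

For the Lipschitz condition, the first identity at (a,b) and at (c,d) gives
   (a - b) (F(a,b) - F(c,d))
     = Phi (f a - f b) - Phi (f c - f d) - F(c,d) ((a - c) - (b - d)).
On [-K,K] the function f is Lipschitz, since H is bounded, and a locally
Lipschitz Phi is Lipschitz on the segment where the increments of f live
([lipschitz_on_segment]); F(c,d) is at most M_K.  So the right-hand side is at
most a constant times |a - c| + |b - d|, and |a - b| >= e.  Since M_K >= 1, a
bound by a multiple of mu is also one by a multiple of m_K. *)

(** * Divided differences, and boundedness on compact sets *)

Definition divided_difference {R : realType} (g dg : R -> R) (a b : R) : R :=
  if a == b then dg a else (g a - g b) / (a - b).

(** A continuous version of g z / z when that quotient has a limit at 0. *)
Definition origin_quotient {R : realType} (g : R -> R) (z : R) : R :=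
  if z == 0 then lim (g t / t @[t --> (0 : R)^']) else g z / z.

Section real_functions.
Context {R : realType}.
Implicit Types (f g : R -> R) (a b K : R).

Lemma derivable_continuous f : (forall x, derivable f x 1) -> continuous f.
Proof.
move=> df x; apply: differentiable_continuous; exact/derivable1_diffP.
Qed.

Lemma divided_differenceK g dg a b :
  divided_difference g dg a b * (a - b) = g a - g b.
Proof.
rewrite /divided_difference; case: eqVneq => [->|ab].
  by rewrite !subrr mulr0.
by rewrite divfK// subr_eq0.
Qed.

(** The mean value theorem with the order of a and b and the case a = b removed:
the mean value point is only located in a ball around x, which is all that
continuity at (x,x) needs. *)
Lemma divided_difference_mean_value f x a b (r : R) :
  (forall x, derivable f x 1) -> `|x - a| < r -> `|x - b| < r ->
  exists2 c, `|x - c| < r & divided_difference f (derive1 f) a b = derive1 f c.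
Proof.
move=> df; wlog ab : a b / a <= b => [hw xa xb|].
  have [ab|/ltW ba] := leP a b; first exact: hw.
  have [c xc hc] := hw _ _ ba xb xa; exists c => //.
  rewrite -hc /divided_difference eq_sym; case: eqP => [->//|_].
  by rewrite -opprB -[a - b]opprB invrN mulrNN.
rewrite /divided_difference; case: eqVneq => [_ xa _|nab xa xb].
  by exists a.
have {}ab : a < b by rewrite lt_neqAle nab.
have fd y : y \in `]a, b[ -> is_derive y 1 f (derive1 f y).
  by move=> _; rewrite derive1E; exact: derivableP.
have cf : {within `[a, b], continuous f}.
  by apply: continuous_subspaceT; exact: derivable_continuous.
have [c cab fba] := MVT ab fd cf.
move: cab; rewrite in_itv/= => /andP[ac cb].
exists c.
  by move: xa xb; rewrite !ltr_norml => /andP[? ?] /andP[? ?]; apply/andP; lra.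
rewrite -[f a - f b]opprB -[a - b]opprB invrN mulrNN fba mulfK//.
by rewrite subr_eq0 gt_eqF.
Qed.

Lemma cvg_increment f a b : continuous f ->
  f p.1 - f p.2 @[p --> (a, b)] --> f a - f b.
Proof.
move=> cf; apply: cvgB.
  by apply: (@cvg_comp _ _ _ fst f _ (nbhs a)); [exact: cvg_fst|exact: cf].
by apply: (@cvg_comp _ _ _ snd f _ (nbhs b)); [exact: cvg_snd|exact: cf].
Qed.

Lemma continuous_divided_difference f :
  (forall x, derivable f x 1) -> continuous (derive1 f) ->
  continuous (fun p : R * R => divided_difference f (derive1 f) p.1 p.2).
Proof.
move=> df cdf [a b].
have [<-{b}|ab] := eqVneq a b.
  apply/cvgrPdist_lt => e e0.
  have /cvgrPdist_lt/(_ _ e0)/nbhs_ballP[r /= r0 hr] := cdf a.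
  near=> p.
  have [] : exists2 c, `|a - c| < r &
      divided_difference f (derive1 f) p.1 p.2 = derive1 f c.
    apply: divided_difference_mean_value => //; near: p.
      by apply: (@cvgr_dist_lt _ _ _ _ _ fst a); [exact: cvg_fst|].
    by apply: (@cvgr_dist_lt _ _ _ _ _ snd a); [exact: cvg_snd|].
  by move=> c ac ->; rewrite /divided_difference/= eqxx; apply: hr.
have quotientE : \forall p \near (a, b), (f p.1 - f p.2) / (p.1 - p.2) =
    divided_difference f (derive1 f) p.1 p.2.
  near=> p.
  have : p.1 - p.2 != 0.
    near: p; apply: (cvgr_neq0 (a - b)); last by rewrite subr_eq0.
    exact: (@cvg_increment id _ _ (fun=> cvg_id)).
  by rewrite subr_eq0 /divided_difference => /negPf ->.
rewrite /continuous_at {2}/divided_difference/= (negPf ab).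
apply: cvg_trans (near_eq_cvg quotientE) _.
apply: cvgM; first by apply: cvg_increment; exact: derivable_continuous.
apply: cvgV; first by rewrite subr_eq0.
exact: (@cvg_increment id _ _ (fun=> cvg_id)).
Unshelve. all: by end_near. Qed.

Lemma continuous_origin_quotient g :
  continuous g -> cvg (g z / z @[z --> (0 : R)^']) ->
  continuous (origin_quotient g).
Proof.
rewrite /origin_quotient => cg cvL z; have [->|z0] := eqVneq z 0.
  apply/continuous_withinNx; rewrite eqxx.
  apply: cvg_trans cvL; apply: near_eq_cvg.
  near=> t.
  have /negPf -> // : t != 0 by near: t; exact: nbhs_dnbhs_neq.
rewrite /continuous_at (negPf z0).
apply: (@cvg_trans _ ((fun t => g t / t) @ z)).
  apply: near_eq_cvg; near=> t.
  have /negPf -> // : t != 0.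
    by near: t; apply: (cvgr_neq0 z); [exact: cvg_id|].
exact: cvgM (cg z) (cvgV z0 cvg_id).
Unshelve. all: by end_near. Qed.

(** The square of pairs (x,y) is compact, so it suffices that the inequality hold
locally on it for all large k.  Near a diagonal point this is the local
Lipschitz property; near any other point |g x - g y| is bounded and |x - y|
stays away from 0. *)
Lemma lipschitz_on_segment g a b :
  continuous g ->
  (forall z : R, exists2 U : set R, nbhs z U & [lipschitz g t | t in U]) ->
  exists2 k, 0 <= k & {in `[a, b] &, forall x y, `|g x - g y| <= k * `|x - y|}.
Proof.
move=> cg lg.
have /compact_near_coveringP cov :=
  compact_setX (@segment_compact R a b) (@segment_compact R a b).
have := cov R +oo%R (fun k p => `|g p.1 - g p.2| <= k * `|p.1 - p.2|) _.
move=> [[x y] _/=|M [Mr hM]].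
  have [<-{y}|xy] := eqVneq x y.
    have [U xU lU] := lg x.
    exists (U `*` U, [set k | forall p, (U `*` U) p ->
        `|g p.1 - g p.2| <= k * `|p.1 - p.2|]).
      by split => //; exists (U, U).
    by move=> [p k] [/= Up hk]; exact: hk.
  near=> p k => /=.
  have num_le : `|g p.1 - g p.2| <= `|g x - g y| + 1.
    near: p; apply: (cvgr_norm_le (g x - g y)); last by rewrite ltrDl.
    exact: cvg_increment.
  have den_ge : `|x - y| / 2 <= `|p.1 - p.2|.
    near: p; apply: (cvgr_norm_ge (x - y)).
      exact: (@cvg_increment id _ _ (fun=> cvg_id)).
    by rewrite ltr_pdivrMr// ltr_pMr ?normr_gt0 ?subr_eq0// ltr1n.
  apply: (le_trans num_le).
  have k_ge : (`|g x - g y| + 1) / (`|x - y| / 2) <= k.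
    by near: k; exact: nbhs_pinfty_ge.
  have k0 : 0 <= k by near: k; exact: nbhs_pinfty_ge.
  apply: le_trans (ler_wpM2l k0 den_ge).
  by rewrite -ler_pdivrMr// divr_gt0// normr_gt0 subr_eq0.
exists (Num.max 0 (M + 1)); first by rewrite le_max lexx.
move=> x y xab yab; apply: (hM (Num.max 0 (M + 1)) _ (x, y)) => //.
by rewrite lt_max ltrDl ltr01 orbT.
Unshelve. all: by end_near. Qed.

(** The bound is taken >= 1 so that mu <= M mu: then M mu also serves in the
Lipschitz condition. *)
Lemma bounded_on_square (h : R * R -> R) K :
  continuous h -> exists2 M, 1 <= M & forall a b,
    a \in `[- K, K] -> b \in `[- K, K] -> `|h (a, b)| <= M.
Proof.
move=> ch.
have cK : compact (`[- K, K] : set R) := @segment_compact R (- K) K.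
have /compact_bounded[B [_ hB]] :=
  continuous_compact (continuous_subspaceT ch) (compact_setX cK cK).
exists (Num.max 1 (B + 1)); first by rewrite le_max lexx.
move=> a b aK bK; apply: (hB (Num.max 1 (B + 1))).
  by rewrite lt_max ltrDl ltr01 orbT.
by exists (a, b).
Qed.

Lemma C1_lipschitz_on_segment f K :
  (forall x, derivable f x 1) -> continuous (derive1 f) -> exists2 k, 0 <= k &
  {in `[- K, K] &, forall x y, `|f x - f y| <= k * `|x - y|}.
Proof.
move=> df cdf.
have [k k1 hk] := bounded_on_square K (continuous_divided_difference df cdf).
exists k; first exact: le_trans k1.
move=> x y xK yK; rewrite -(divided_differenceK f (derive1 f)) normrM.
by rewrite ler_wpM2r//; exact: hk.
Qed.

End real_functions.

(** * Measurability, and scaling of densities *)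

Section measurability.
Context {R : realType}.

(** The inverse is continuous on the complement of 0, which is open, and {0} is a
measurable set. *)
Lemma measurable_inv : measurable_fun [set: R] (fun x : R => x^-1).
Proof.
pose h (x : R) := if x == 0 then 0 else x^-1.
rewrite [X in measurable_fun _ X](_ : _ = h); last first.
  by apply/funext => x; rewrite /h; case: eqP => // ->; rewrite invr0.
apply: measurable_fun_if => //; first exact: measurable_fun_eqr.
have -> : [set: R] `&` (fun x => x == 0) @^-1` [set false] = [set x | x != 0].
  by apply/seteqP; split => x /=; [case=> _ -> |move=> /negPf].
apply: open_continuous_measurable_fun; first exact: open_neq.
by move=> x; rewrite inE/= => x0; exact: inv_continuous.
Qed.

Lemma measurable_sqrt d (T : measurableType d) (g : T -> R) :
  measurable_fun setT g -> measurable_fun setT (fun t => Num.sqrt (g t)).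
Proof.
move=> mg; have msqrt : measurable_fun [set: R] (@Num.sqrt R).
  by apply: continuous_measurable_fun; exact: sqrt_continuous.
exact: measurableT_comp msqrt mg.
Qed.

Context {N : nat}.

Lemma measurable_eucl_norm : measurable_fun [set: N.-tuple R] (@eucl_norm R N).
Proof.
apply: measurable_sqrt; apply: measurable_sum => i; apply: measurable_funX.
exact: measurable_tnth.
Qed.

Lemma measurable_eucl_dist :
  measurable_fun setT (fun xy : N.-tuple R * N.-tuple R => eucl_dist xy.1 xy.2).
Proof.
apply: measurable_sqrt; apply: measurable_sum => i.
under eq_fun do rewrite tnth_mktuple.
apply: measurable_funX; apply: measurable_funB.
  exact: (measurableT_comp (measurable_tnth i) measurable_fst).
exact: (measurableT_comp (measurable_tnth i) measurable_snd).
Qed.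

Lemma measurable_radial d (T : measurableType d) (mu : R -> R) (r : T -> R) :
  measurable_fun (`[0, +oo[ : set R) mu -> measurable_fun setT r ->
  (forall t, 0 <= r t) ->
  measurable_fun setT (fun t => mu (r t)).
Proof.
move=> mmu mr r0; have r_ge0 : r @` setT `<=` (`[0, +oo[ : set R).
  by move=> _ [t _ <-] /=; rewrite in_itv/= andbT.
by apply: (measurable_comp _ r_ge0 mmu mr); exact: measurable_itv.
Qed.

Lemma low_singularity_densityZ (C : R) (mu : R -> R) :
  0 <= C -> low_singularity_density N mu ->
  low_singularity_density N (fun r => C * mu r).
Proof.
move=> C0 [mmu mu0 Imu]; split.
- exact: measurable_funM.
- by move=> r r0; rewrite mulr_ge0// mu0.
under eq_integral do rewrite mulrCA EFinM.
rewrite ge0_integralZl//.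
- exact: lte_mul_pinfty.
- apply/measurable_EFinP; apply: measurable_funM.
    by apply: measurable_minr => //; exact: measurable_eucl_norm.
  apply: measurable_radial => //; first exact: measurable_eucl_norm.
  by move=> y; exact: sqrtr_ge0.
- move=> y _; rewrite lee_fin mulr_ge0 ?mu0 ?sqrtr_ge0//.
  by rewrite le_min ler01 sqrtr_ge0.
Qed.

End measurability.

(** * The function F *)

Section jump_rate.
Context {R : realType} (f Phi : R -> R).
Context (df : forall x : R, derivable f x 1) (cdf : continuous (derive1 f))
  (ndf : {homo f : x y / x <= y})
  (cPhi : continuous Phi) (ndPhi : {homo Phi : x y / x <= y})
  (oddPhi : forall z, Phi (- z) = - Phi z)
  (limPhi : cvg (Phi z / z @[z --> (0 : R)^']))
  (lipPhi : forall z : R,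
    exists2 U : set R, nbhs z U & [lipschitz Phi t | t in U]).

Local Notation F := (difference_quotient f Phi).

Lemma odd_at0 : Phi 0 = 0.
Proof. by have := oddPhi 0; rewrite oppr0; lra. Qed.

Lemma difference_quotientK a b : (a - b) * F a b = Phi (f a - f b).
Proof.
rewrite /difference_quotient; case: eqVneq => [->|ab].
  by rewrite !subrr mul0r odd_at0.
by rewrite mulrC divfK// subr_eq0.
Qed.

Lemma difference_quotient_sym a b : F a b = F b a.
Proof.
have [->//|ab] := eqVneq a b.
have ab0 : a - b != 0 by rewrite subr_eq0.
apply: (mulfI ab0); rewrite difference_quotientK.
by rewrite -[a - b]opprB mulNr difference_quotientK -oddPhi opprB.
Qed.

(** If a <> b and f a = f b, the first factor is the limit at 0 rather than a
quotient, but then both the second factor and F(a,b) vanish. *)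
Lemma difference_quotient_factor a b :
  F a b =
  origin_quotient Phi (f a - f b) * divided_difference f (derive1 f) a b.
Proof.
rewrite /difference_quotient /origin_quotient /divided_difference.
case: (eqVneq a b) => [->|ab]; first by rewrite subrr eqxx mulrC.
case: (eqVneq (f a - f b) 0) => [->|fab]; first by rewrite odd_at0 !mul0r mulr0.
by rewrite mulrA divfK.
Qed.

Lemma continuous_difference_quotient : continuous (fun p : R * R => F p.1 p.2).
Proof.
under eq_fun do rewrite difference_quotient_factor.
move=> [a b]; apply: cvgM; last exact: continuous_divided_difference.
apply: (@cvg_comp _ _ _ (fun p : R * R => f p.1 - f p.2) (origin_quotient Phi)
  _ (nbhs (f a - f b))).
  by apply: cvg_increment; exact: derivable_continuous.
exact: continuous_origin_quotient.
Qed.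

(** The diagonal values are limits of off-diagonal ones, whose sign is read off
[difference_quotientK]. *)
Lemma difference_quotient_ge0 a b : 0 <= F a b.
Proof.
have neq_ge0 x y : x != y -> 0 <= F x y.
  rewrite neq_lt => /orP[xy|xy].
    rewrite -(nmulr_rle0 _ (_ : x - y < 0)) ?subr_lt0// difference_quotientK.
    by rewrite -odd_at0; apply: ndPhi; rewrite subr_le0 ndf// ltW.
  rewrite -(pmulr_rge0 _ (_ : 0 < x - y)) ?subr_gt0// difference_quotientK.
  by rewrite -odd_at0; apply: ndPhi; rewrite subr_ge0 ndf// ltW.
have [<-|] := eqVneq a b; last exact: neq_ge0.
have cFa : F a y @[y --> a^'] --> F a a.
  have : {for a, continuous (F a)}.
    apply: (@cvg_comp _ _ _ (fun y => (a, y)) (fun p : R * R => F p.1 p.2)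
      _ (nbhs (a, a))); last exact: (@continuous_difference_quotient (a, a)).
    exact: cvg_pair (cvg_cst a) cvg_id.
  by move/continuous_withinNx.
rewrite -(cvg_lim _ cFa)//; apply: limr_ge.
  by apply/cvg_ex; exists (F a a).
near=> y; apply: neq_ge0; rewrite eq_sym.
by near: y; exact: nbhs_dnbhs_neq.
Unshelve. all: by end_near. Qed.

Lemma measurable_difference_quotient :
  measurable_fun [set: R * R] (fun p => F p.1 p.2).
Proof.
have mf : measurable_fun [set: R] f.
  by apply: continuous_measurable_fun; exact: derivable_continuous.
have mdf : measurable_fun [set: R] (derive1 f).
  exact: continuous_measurable_fun.
have mPhi : measurable_fun [set: R] Phi by exact: continuous_measurable_fun.
apply: measurable_fun_ifT.
- exact: measurable_fun_eqr.
- by apply: measurable_funM => //; exact: (measurableT_comp mdf measurable_fst).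
- apply: measurable_funM.
    apply: (measurableT_comp mPhi); apply: measurable_funB.
      exact: (measurableT_comp mf measurable_fst).
    exact: (measurableT_comp mf measurable_snd).
  apply: (measurableT_comp measurable_inv); exact: measurable_funB.
Qed.

Lemma difference_quotient_lipschitz K e : 0 < e -> exists C, forall a b c d,
  a \in `[- K, K] -> b \in `[- K, K] -> c \in `[- K, K] -> d \in `[- K, K] ->
  e <= `|a - b| -> e <= `|c - d| ->
  `|F a b - F c d| <= C * (`|a - c| + `|b - d|).
Proof.
move=> e0.
have [M M1 hM] := bounded_on_square K continuous_difference_quotient.
have [kf kf0 hf] := C1_lipschitz_on_segment K df cdf.
pose B := kf * (`|K| + `|K|).
have [kP kP0 hP] := lipschitz_on_segment (- B) B cPhi lipPhi.
have incrB x y : x \in `[- K, K] -> y \in `[- K, K] -> f x - f y \in `[- B, B].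
  move=> xK yK; rewrite in_itv/= -ler_norml; apply: le_trans (hf _ _ xK yK) _.
  apply: ler_wpM2l => //; apply: le_trans (ler_normB _ _) _.
  move: xK yK; rewrite !in_itv/= -!ler_norml => xK yK.
  by apply: lerD; [apply: le_trans xK _|apply: le_trans yK _]; exact: ler_norm.
exists ((kP * kf + M) / e) => a b c d aK bK cK dK eab ecd.
have Phi_incr : `|Phi (f a - f b) - Phi (f c - f d)| <=
    kP * kf * (`|a - c| + `|b - d|).
  apply: le_trans (hP _ _ (incrB _ _ aK bK) (incrB _ _ cK dK)) _.
  rewrite -mulrA ler_wpM2l//.
  have -> : f a - f b - (f c - f d) = (f a - f c) - (f b - f d) by ring.
  apply: le_trans (ler_normB _ _) _.
  by rewrite mulrDr lerD// hf.
have key : (a - b) * (F a b - F c d) =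
    Phi (f a - f b) - Phi (f c - f d) - F c d * ((a - c) - (b - d)).
  rewrite -!difference_quotientK; ring.
rewrite mulrAC ler_pdivlMr// mulrC.
apply: (@le_trans _ _ (`|a - b| * `|F a b - F c d|)).
  by rewrite ler_wpM2r.
rewrite -normrM key; apply: le_trans (ler_normB _ _) _.
rewrite mulrDl lerD// normrM ler_pM//; first exact: hM.
exact: ler_normB.
Qed.

End jump_rate.

Theorem proposition5p9 (R : realType) (N : nat) (N_gt0 : (0 < N)%N)
    (f Phi mu : R -> R)
    (f_derivable : forall x : R, derivable f x 1)
    (f_C1 : continuous (derive1 f))
    (f_nondecreasing : {homo f : x y / x <= y})
    (Phi_continuous : continuous Phi)
    (Phi_nondecreasing : {homo Phi : x y / x <= y})
    (Phi_ge0 : forall z : R, 0 <= z -> 0 <= Phi z)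
    (Phi_odd : forall z : R, Phi (- z) = - Phi z)
    (Phi_lipschitz : forall z : R,
      exists2 U : set R, nbhs z U & [lipschitz Phi t | t in U])
    (Phi_limit : cvg (Phi z / z @[z --> (0 : R)^']))
    (mu_density : low_singularity_density N mu) :
  homogeneous_jump_kernel
    (fun (ab : R * R) (xy : N.-tuple R * N.-tuple R) =>
       difference_quotient f Phi ab.1 ab.2 * mu (eucl_dist xy.1 xy.2)).
Proof.
have cF := continuous_difference_quotient f_derivable f_C1
  Phi_continuous Phi_odd Phi_limit.
have F_ge0 := difference_quotient_ge0 f_derivable f_C1 f_nondecreasing
  Phi_continuous Phi_nondecreasing Phi_odd Phi_limit.
have dist_ge0 (x y : N.-tuple R) : 0 <= eucl_dist x y by exact: sqrtr_ge0.
have [mmu mu_ge0 _] := mu_density.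
split.
- split=> [|ab xy]; last by rewrite mulr_ge0// mu_ge0.
  apply: measurable_funM.
    have mF := measurable_difference_quotient f_derivable f_C1 Phi_continuous.
    exact: (measurableT_comp mF measurable_fst).
  apply: measurable_radial => //.
  exact: (measurableT_comp measurable_eucl_dist measurable_snd).
- apply: aeW => -[x y] /= a b.
  rewrite (difference_quotient_sym f Phi_odd); congr (_ * mu _).
  congr Num.sqrt; apply: eq_bigr => i _.
  by rewrite !tnth_mktuple -sqrrN opprB.
- apply: aeW => -[x y] /= a b c d ca dc bd.
  rewrite !mulrA !(difference_quotientK f Phi_odd) ler_wpM2r ?mu_ge0//.
  by apply: Phi_nondecreasing; apply: lerB; exact: f_nondecreasing.
- exists (fun ab r => difference_quotient f Phi ab.1 ab.2 * mu r).
  exact: aeW.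
have /choice[M hM] : forall K, exists M : R, 1 <= M /\ forall a b,
    a \in `[- K, K] -> b \in `[- K, K] -> `|difference_quotient f Phi a b| <= M.
  by move=> K; have [M M1 hM] := bounded_on_square K cF; exists M.
exists (fun K r => M K * mu r); split.
- move=> K K0; have [MK1 hMK] := hM K; split.
    apply: aeW => -[x y] /=; apply: ge_ereal_sup => _ [[a b] [/= aK bK] <-].
    rewrite lee_fin ler_wpM2r ?mu_ge0//.
    by apply: le_trans (ler_norm _) _; exact: hMK.
  by apply: low_singularity_densityZ => //; exact: le_trans MK1.
- apply: aeW => -[x y] /= ab.
  by apply: cvgM; [exact: cF|exact: cvg_cst].
move=> e K e0 eK; have [MK1 _] := hM K.
have [C hC] := difference_quotient_lipschitz f_derivable f_C1
  Phi_continuous Phi_odd Phi_limit Phi_lipschitz K e0.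
exists C; apply: aeW => -[x y] /= a b c d aK bK cK dK eab ecd.
have mu0 : 0 <= mu (eucl_dist x y) by exact: mu_ge0.
rewrite -mulrBl normrM (ger0_norm mu0).
have FC := hC _ _ _ _ aK bK cK dK eab ecd.
apply: ler_pM => //.
(* [m K] is [M K * mu], and [M K >= 1] *)
by rewrite ler_peMl.
Qed.
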